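(* If $\Delta$ is a non-degenerate $k$-simplex in $\mathbb{R}^k$, then $\mathrm{Sim}(\Delta)$ (the closure in $C_{k+1}[\mathbb{R}^k]$ of the space of simplices similar to $\Delta$) is a submanifold of $C_{k+1}[\mathbb{R}^k]$ that is diffeomorphic to $\mathrm{O}(k)\times[0,\infty)\times\mathbb{R}^k$.
   Context: $C_{k+1}(\mathbb{R}^k)\subset(\mathbb{R}^k)^{k+1}$ is the open subspace of $(k+1)$-tuples $\mathbf q=(\mathbf q_0,\dots,\mathbf q_k)$ of pairwise distinct points. For distinct indices, $\pi_{ij}(\mathbf q)=\frac{\mathbf q_i-\mathbf q_j}{|\mathbf q_i-\mathbf q_j|}\in S^{k-1}$ and $r_{ijl}(\mathbf q)=\frac{|\mathbf q_i-\mathbf q_j|}{|\mathbf q_i-\mathbf q_l|}\in[0,\infty]$, where $[0,\infty]$ is the one-point compactification of $[0,\infty)$. With $n=k+1$, $C_{n}[\mathbb{R}^k]$ is the closure of the image of $C_{n}(\mathbb{R}^k)$ under $(\iota,(\pi_{ij}),(r_{ijl}))$ in $(\mathbb{R}^k)^n\times(S^{k-1})^{n(n-1)}\times[0,\infty]^{n(n-1)(n-2)}$ ($\iota$ the inclusion). It is a manifold with boundary and corners with interior $C_{n}(\mathbb{R}^k)$. The $(0,1,\dots,k)$-face of its boundary is the boundary component of configurations in which all points have come together; near the interior of this face (where all $r_{ijl}\in(0,\infty)$) smooth coordinates are $(\mathbf x,t,\mathbf u)\in\mathbb{R}^k\times[0,\infty)\times\{(\mathbf u_0,\dots,\mathbf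 u_k)\ \text{pairwise distinct},\ \sum\mathbf u_i=0,\ \sum|\mathbf u_i|^2=1\}$, corresponding to $\mathbf q_i=\mathbf x+t\mathbf u_i$, where $t=0$ means the limit as $t\to0^+$. A non-degenerate $k$-simplex is $\Delta=(\mathbf p_0,\dots,\mathbf p_k)\in C_{k+1}(\mathbb{R}^k)$ such that no hyperplane contains more than $k$ of the points. The space of simplices similar to $\Delta$ is $\{\mathbf q\in C_{k+1}(\mathbb{R}^k): r_{ijl}(\mathbf q)=r_{ijl}(\Delta)\ \text{for all distinct } i,j,l\}$. *)

(* Defs.v *)
From HB Require Import structures.
From mathcomp Require Import all_boot all_order all_algebra.
From mathcomp Require Import all_classical all_reals all_analysis.

Set Implicit Arguments.
Unset Strict Implicit.
Unset Printing Implicit Defensive.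
Import Order.TTheory GRing.Theory Num.Theory.
Import numFieldNormedType.Exports.
Local Open Scope classical_set_scope.
Local Open Scope ring_scope.

(** ** Smooth maps between subsets of normed spaces *)

(* On an open set [U] this is the class C^n (in finite dimension, a C^n map
   has all its directional derivatives of class C^(n-1), and conversely). *)
Fixpoint Ck (R : realType) (V W : normedModType R) (n : nat)
    (U : set V) (f : V -> W) : Prop :=
  if n is m.+1 then
    (forall x, U x -> differentiable f x) /\ (forall v, Ck m U ('D_v f))
  else forall x, U x -> {for x, continuous f}.

(* [X] is an arbitrary subset: [f] is smooth on [X] when it extends to a
   C^infty map near each point of [X]. *)
Definition smooth_on (R : realType) (V W : normedModType R)
    (X : set V) (f : V -> W) : Prop :=
  forall x, X x -> exists (U : set V) (g : V -> W),
    [/\ open_nbhs x U, forall n, Ck n U g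
      & forall y, X y -> U y -> g y = f y].

(** ** Submanifolds of a space with smooth coordinates *)

Section Coordinates.
(* A part of the topological space [T] has the smooth coordinates [D], a subset
   of the normed space [E]; [phi e] is the point of [T] of coordinates [e]. *)
Variables (R : realType) (T : topologicalType) (E : normedModType R).
Variables (D : set E) (phi : E -> T).

Definition smooth_to (V : normedModType R) (X : set V) (f : V -> T) : Prop :=
  {within X, continuous f} /\
  exists2 g : V -> E, smooth_on X g & forall x, X x -> D (g x) /\ phi (g x) = f x.

Definition smooth_from (V : normedModType R) (S : set T) (h : T -> V) : Prop :=
  {within S, continuous h} /\ smooth_on (D `&` phi @^-1` S) (h \o phi).

Definition diffeomorphic (V : normedModType R) (X : set V) (S : set T) : Prop :=
  exists (f : V -> T) (h : T -> V),
    [/\ forall x, X x -> S (f x) /\ h (f x) = x,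
        forall p, S p -> X (h p) /\ f (h p) = p,
        smooth_to X f
      & smooth_from S h].

(* [0, +oo[^m x R^(d - m), for m <= d *)
Definition quadrant (d m : nat) : set 'rV[R]_d :=
  [set y | forall i : 'I_d, (i < m)%N -> 0 <= y 0 i].

(* Embedded submanifold, possibly with boundary and corners: a subset locally
   diffeomorphic, for the subspace topology and the smooth structure of the
   ambient space, to open subsets of quadrants.  The smooth inverse of the
   parametrization forces it to be an immersion. *)
Definition submanifold (M S : set T) : Prop :=
  S `<=` M /\
  exists d : nat, forall p, S p ->
    exists (m : nat) (G : set 'rV[R]_d) (U : set T),
      [/\ open G, open_nbhs p U
        & diffeomorphic (G `&` quadrant m) (S `&` U)].

End Coordinates.

(** ** The compactified configuration space *)

Section Configurations.
Variables (R : realType) (k : nat).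

Definition dot (v w : 'rV[R]_k) : R := \sum_j v 0 j * w 0 j.
Definition enorm (v : 'rV[R]_k) : R := Num.sqrt (dot v v).

Definition dpairs (n : nat) := {ij : 'I_n * 'I_n | ij.1 != ij.2}.
Definition dtriples (n : nat) :=
  {ijl : 'I_n * 'I_n * 'I_n | uniq [:: ijl.1.1; ijl.1.2; ijl.2]}.

Variable n : nat.

(* Row [i] of [q] is the point q_i. *)
Definition config : set 'M[R]_(n, k) :=
  [set q | forall i j, i != j -> row i q != row j q].

Definition direction (q : 'M[R]_(n, k)) (i j : 'I_n) : 'rV[R]_k :=
  (enorm (row i q - row j q))^-1 *: (row i q - row j q).

Definition ratio (q : 'M[R]_(n, k)) (i j l : 'I_n) : R :=
  enorm (row i q - row j q) / enorm (row i q - row l q).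

Definition ambient : topologicalType :=
  ('M[R]_(n, k) * {ptws dpairs n -> 'rV[R]_k}
    * {ptws dtriples n -> \bar R})%type.

(* (R^k)^n x (S^(k-1))^(n(n-1)) x [0, +oo]^(n(n-1)(n-2)) *)
Definition target : set ambient :=
  [set z | (forall ij, enorm (z.1.2 ij) = 1) /\ (forall ijl, (0 <= z.2 ijl)%E)].

Definition directions (q : 'M[R]_(n, k)) : {ptws dpairs n -> 'rV[R]_k} :=
  fun ij => direction q (val ij).1 (val ij).2.

Definition ratios (q : 'M[R]_(n, k)) : {ptws dtriples n -> \bar R} :=
  fun ijl => (ratio q (val ijl).1.1 (val ijl).1.2 (val ijl).2)%:E.

Definition embed (q : 'M[R]_(n, k)) : ambient := (q, directions q, ratios q).

(* C_n[R^k] *)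
Definition compactified : set ambient :=
  target `&` closure (embed @` config).

(** Smooth coordinates (x, t, u) on the union of the interior and of the
    interior of the face where all points have come together. *)

Definition collar_space : normedModType R := ('rV[R]_k * R^o * 'M[R]_(n, k))%type.

Definition collar_dom : set collar_space :=
  [set z | [/\ 0 <= z.1.2, config z.2, \sum_i row i z.2 = 0
             & \sum_i enorm (row i z.2) ^+ 2 = 1]].

(* The configuration q_i = x + t u_i *)
Definition place (x : 'rV[R]_k) (t : R) (u : 'M[R]_(n, k)) : 'M[R]_(n, k) :=
  \matrix_(i, j) (x 0 j + t * u i j).

(* Directions and ratios are the same for u and for [place x t u] with t > 0,
   so for t > 0 this is the embedded configuration x + t u, and for t = 0 it is
   its limit as t -> 0+: see [collar_gt0] and [collar_cvg0].  In the interior x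
   and t are the centroid of q and its size, smooth functions of q, so that
   these coordinates give the standard smooth structure of [config]. *)
Definition collar (z : collar_space) : ambient :=
  (place z.1.1 z.1.2 z.2, directions z.2, ratios z.2).

Lemma enormZ (t : R) (v : 'rV[R]_k) : 0 <= t -> enorm (t *: v) = t * enorm v.
Proof.
move=> t0; have : dot (t *: v) (t *: v) = t ^+ 2 * dot v v.
  by rewrite /dot mulr_sumr; apply: eq_bigr => j _; rewrite !mxE mulrACA expr2.
by rewrite /enorm => ->; rewrite sqrtrM ?sqr_ge0// sqrtr_sqr ger0_norm.
Qed.

Lemma place_rowB x t u i j :
  row i (place x t u) - row j (place x t u) = t *: (row i u - row j u).
Proof.
by apply/rowP => l; rewrite !mxE opprD addrACA subrr add0r mulrBr.
Qed.

Lemma collar_gt0 (z : collar_space) :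
  0 < z.1.2 -> collar z = embed (place z.1.1 z.1.2 z.2).
Proof.
case: z => -[x t] u /= t0; congr (_, _, _).
  apply/funext => ij; rewrite /directions /direction place_rowB enormZ ?ltW//.
  by rewrite scalerA invfM mulrAC mulVf ?gt_eqF// mul1r.
apply/funext => ijl; rewrite /ratios /ratio !place_rowB !enormZ ?ltW//.
by rewrite -mulf_div divff ?gt_eqF// mul1r.
Qed.

Lemma collar_cvg0 (x : 'rV[R]_k) (u : 'M[R]_(n, k)) :
  (embed (place x t u) @[t --> 0^'+] : set_system ambient)
    --> (collar (x, 0, u) : ambient).
Proof.
have cp : (fun t : R => place x t u) @ 0^'+ --> place x 0 u.
  have E t : place x t u = place x 0 u + t *: u.
    by apply/matrixP => i j; rewrite !mxE mul0r addr0.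
  suff : place x 0 u + t *: u @[t --> 0^'+] --> place x 0 u + 0 *: u.
    by rewrite -E; apply: cvg_trans; apply: near_eq_cvg; exact: nearW.
  apply: cvgD; first exact: cvg_cst.
  by apply: cvgZr_tmp; apply: cvg_at_right_filter; exact: cvg_id.
have ce : (collar (x, t, u) @[t --> 0^'+] : set_system ambient)
    --> (collar (x, 0, u) : ambient).
  have cd : (fun=> directions u) @ (0 : R)^'+ --> directions u by exact: cvg_cst.
  have cr : (fun=> ratios u) @ (0 : R)^'+ --> ratios u by exact: cvg_cst.
  exact: cvg_pair (cvg_pair cp cd) cr.
apply: cvg_trans ce; apply: near_eq_cvg; near=> t.
by apply: (collar_gt0 (z := (x, t, u))) => /=; near: t; exact: nbhs_right_gt.
Unshelve. all: by end_near. Qed.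

End Configurations.

(** ** Simplices *)

Section Simplices.
Variables (R : realType) (k : nat).

Definition nondegenerate_simplex (p : 'M[R]_(k.+1, k)) : Prop :=
  config p /\
  forall (a : 'rV[R]_k) (b : R), a != 0 ->
    (#|[pred i | dot a (row i p) == b]| <= k)%N.

Definition similar_simplices (p : 'M[R]_(k.+1, k)) : set 'M[R]_(k.+1, k) :=
  [set q | config q /\
     forall i j l, uniq [:: i; j; l] -> ratio q i j l = ratio p i j l].

(* Sim(p), the closure being taken in C_(k+1)[R^k] *)
Definition Sim (p : 'M[R]_(k.+1, k)) : set (ambient R k k.+1) :=
  @compactified R k k.+1 `&` closure (@embed R k k.+1 @` similar_simplices p).

Definition orthogonal_group : set 'M[R]_k := [set A | A *m A^T = 1%:M].

(* O(k) x [0, +oo[ x R^k *)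
Definition model : set ('M[R]_k * R^o * 'rV[R]_k)%type :=
  [set z | orthogonal_group z.1.1 /\ 0 <= z.1.2].

End Simplices.

(* Main.v *)
(* Centring and rescaling, write the simplex as p_i = x + t u_i with
   sum_i u_i = 0 and sum_i |u_i|^2 = 1.  Equal ratios of distances mean that all
   distances are proportional, so by polarization the Gram matrices of the edge
   vectors are proportional; the edge matrix of u being invertible, every simplex
   similar to p is y + s (u A) for a unique A in O(k), s > 0 and y.  Thus Sim(p)
   is the image of O(k) x [0, +oo[ x R^k under (A, s, y) |-> collar (y, s, u A).
   The image is closed because this map has a continuous left inverse defined on
   the whole ambient space: A is read off linearly from the directions (also on
   the face s = 0), then s = sum_i <q_i, u_i A>, and y is the centroid.  In the
   smooth coordinates the inverse is linear.  Charts of the submanifold come from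
   the Cayley transform, which parametrizes by skew-symmetric matrices the open set
   of those A in O(k) for which -1 is not an eigenvalue of A0^T A. *)

From HB Require Import structures.
From mathcomp Require Import all_boot all_order all_algebra ring.
From mathcomp Require Import all_classical all_reals all_analysis.
Require Import Defs.

Set Implicit Arguments.
Unset Strict Implicit.
Unset Printing Implicit Defensive.
Import Order.TTheory GRing.Theory Num.Theory.
Import numFieldNormedType.Exports.
Local Open Scope classical_set_scope.
Local Open Scope ring_scope.

(** * Smooth maps *)

Section SmoothCalculus.
Variable R : realType.
Implicit Types U V W : normedModType R.

(** Near [x] both maps have the same first-order expansion, so uniqueness of the differential gives
    ['d g x = 'd f x]. *)
Lemma near_eq_differentiable V W (f g : V -> W) x :
  (\near x, f x = g x) -> differentiable f x -> differentiable g x.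
Proof.
move=> fg /diff_locallyP[cf Ef].
have fgx : f x = g x by exact: nbhs_singleton fg.
have E : g \o shift x = cst (g x) + 'd f x +o_ (0 : V) id.
  apply/eqaddoP => e e0; move/eqaddoP/(_ e e0) : Ef.
  move: fg; rewrite (near_shift 0) subr0 => fg.
  by apply: filterS2 fg => h /= fgh; rewrite !fctE /= fgx fgh.
have dg : 'd g x = 'd f x :> (V -> W) by exact: diff_unique.
by apply/diff_locallyP; rewrite dg.
Qed.

(** Openness of [A] turns equality on [A] into equality near each of its points, so the directional
    derivatives agree on [A] as well and the induction continues. *)
Lemma Ck_ext V W n (A : set V) (f g : V -> W) : open A ->
  (forall x, A x -> f x = g x) -> Ck n A f -> Ck n A g.
Proof.
move=> oA; elim: n f g => [|n IH] f g fg /=.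
  move=> cf x Ax; have nx : \near x, f x = g x.
    by near do apply: fg; exact: open_nbhs_nbhs.
  have : f @ x --> g x by rewrite -(fg _ Ax); exact: cf.
  by apply: cvg_trans; apply: near_eq_cvg.
have nx x : A x -> \near x, f x = g x.
  by move=> Ax; near do apply: fg; exact: open_nbhs_nbhs.
move=> [df Df]; split => [x Ax|v].
  by apply: near_eq_differentiable (df x Ax); exact: nx.
apply: IH (Df v) => x Ax; exact/near_eq_derive/nx.
Unshelve. all: by end_near. Qed.

Lemma Ck_pred V W n (A : set V) (f : V -> W) : Ck n.+1 A f -> Ck n A f.
Proof.
elim: n f => [|n IH] f [df Df]; first by move=> x /df/differentiable_continuous.
by split=> // v; exact/IH/Df.
Qed.

Lemma Ck_cst V W n (A : set V) (c : W) : Ck n A (cst c).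
Proof.
elim: n c => [|n IH] c /=; first by move=> x _; exact: cvg_cst.
split=> // v.
by rewrite (_ : 'D_v _ = cst 0)//; apply/funext => x; rewrite derive_cst.
Qed.

Lemma Ck_linear V W n (A : set V) (f : {linear V -> W}) :
  continuous f -> Ck n A f.
Proof.
move=> cf; case: n => [x _|n /=]; first exact: cf.
split=> [x _|v]; first exact: linear_differentiable.
rewrite (_ : 'D_v _ = cst (f v)); first exact: Ck_cst.
apply/funext => x; rewrite deriveE; last exact: linear_differentiable.
by rewrite diff_lin.
Qed.

Lemma CkD V W n (A : set V) (f g : V -> W) : open A ->
  Ck n A f -> Ck n A g -> Ck n A (f + g).
Proof.
move=> oA; elim: n f g => [|n IH] f g /=.
  by move=> cf cg x Ax; apply: cvgD; [exact: cf|exact: cg].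
move=> [df Df] [dg Dg]; split=> [x Ax|v].
  by apply: differentiableD; [exact: df|exact: dg].
apply: Ck_ext (IH _ _ (Df v) (Dg v)) => // x Ax.
by rewrite deriveD//; apply: diff_derivable; [exact: df|exact: dg].
Qed.

(** On [A], ['D_v (L \o f)] is [L \o 'D_v f], which has again the shape of the statement. *)
Lemma Ck_postcomp U V W n (A : set U) (L : {linear V -> W}) (f : U -> V) :
  open A -> continuous L -> Ck n A f -> Ck n A (L \o f).
Proof.
move=> oA cL; elim: n f => [|n IH] f /=.
  by move=> cf x Ax; apply: continuous_comp; [exact: cf|exact: cL].
have dL y : differentiable L y by exact: linear_differentiable.
move=> [df Df]; split=> [x Ax|v].
  by apply: differentiable_comp; [exact: df|].
apply: Ck_ext (IH _ (Df v)) => // x Ax.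
have dfx := df _ Ax.
rewrite deriveE; last exact: differentiable_comp.
by rewrite diff_comp//= diff_lin//= deriveE.
Qed.

(** Here ['D_v (f \o L)] is ['D_(L v) f \o L]: the direction changes, which the quantification over
    all directions in [Ck] allows. *)
Lemma Ck_precomp U V W n (A : set V) (L : {linear U -> V}) (f : V -> W) :
  open A -> continuous L -> Ck n A f -> Ck n (L @^-1` A) (f \o L).
Proof.
move=> oA cL; have oLA : open (L @^-1` A) by apply: open_comp => // *; exact: cL.
elim: n f => [|n IH] f /=.
  by move=> cf x Ax; apply: continuous_comp; [exact: cL|exact: cf].
have dL y : differentiable L y by exact: linear_differentiable.
move=> [df Df]; split=> [x Ax|v].
  by apply: differentiable_comp; [|exact: df].
apply: Ck_ext (IH _ (Df (L v))) => // x Ax.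
have dfx := df _ Ax.
rewrite deriveE; last exact: differentiable_comp.
by rewrite diff_comp//= diff_lin//= deriveE.
Qed.

(** By the Leibniz rule the derivative of a product involves the factors themselves, one class lower
    by [Ck_pred], next to their derivatives. *)
Lemma CkM V n (A : set V) (f g : V -> R^o) : open A ->
  Ck n A f -> Ck n A g -> Ck n A (f * g : V -> R^o).
Proof.
move=> oA; elim: n f g => [|n IH] f g.
  by move=> cf cg x Ax; apply: (@cvgM R); [exact: cf|exact: cg].
move=> Cf Cg; have [df Df] := Cf; have [dg Dg] := Cg; split=> [x Ax|v].
  by apply: (@differentiableM R V f g x); [exact: df|exact: dg].
apply: (@Ck_ext _ _ _ _ (f * 'D_v g + g * 'D_v f : V -> R^o)) => //.
  by move=> x Ax; apply/esym/deriveM;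
    [exact: (diff_derivable (df x Ax))|exact: (diff_derivable (dg x Ax))].
by apply: CkD => //; apply: IH => //;
  [exact: Ck_pred Cf|exact: Dg|exact: Ck_pred Cg|exact: Df].
Qed.

Lemma CkV V n (A : set V) (f : V -> R^o) : open A ->
  (forall x, A x -> f x != 0) ->
  Ck n A f -> Ck n A (fun x => (f x)^-1 : R^o).
Proof.
move=> oA f0; elim: n => [|n IH].
  by move=> cf x Ax; apply: (@cvgV R); [exact: f0|exact: cf].
move=> Cf; have [df Df] := Cf; split=> [x Ax|v].
  by apply: (@differentiableV R V f x); [exact: df|exact: f0].
(* The derivative of [1/f] is [- (1/f) (1/f) 'D_v f], a product in which [1/f] is covered by the
   induction hypothesis. *)
have Cfi := IH (Ck_pred Cf).
apply: (@Ck_ext _ _ _ _ ((cst (-1) : V -> R^o) *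
  ((fun x => (f x)^-1) * (fun x => (f x)^-1)) * 'D_v f : V -> R^o)) => //.
  move=> x Ax; rewrite deriveV; [|exact: f0|exact: (diff_derivable (df x Ax))].
  rewrite [LHS](_ : _ = -1 * ((f x)^-1 * (f x)^-1) * 'D_v f x)//.
  by rewrite -invfM -expr2 mulN1r.
have C1 : Ck n A (cst (-1) : V -> R^o) by exact: Ck_cst.
by apply: CkM => //; [do 2 apply: CkM => //|exact: Df].
Qed.


Definition Cinf V W (A : set V) (f : V -> W) := forall n, Ck n A f.

Lemma Cinf_ext V W (A : set V) (f g : V -> W) : open A ->
  (forall x, A x -> f x = g x) -> Cinf A f -> Cinf A g.
Proof. by move=> oA fg cf n; exact: Ck_ext fg (cf n). Qed.

Lemma Cinf_cst V W (A : set V) (c : W) : Cinf A (fun=> c).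
Proof. by move=> n; exact: Ck_cst. Qed.

Lemma Cinf_linear V W (A : set V) (f : V -> W) :
  linear f -> continuous f -> Cinf A f.
Proof.
move=> lf cf n; pose lM := GRing.isLinear.Build _ _ _ _ _ lf.
pose L : {linear _ -> _} := HB.pack f lM.
exact: (@Ck_linear _ _ _ _ L).
Qed.

Lemma Cinf_postcomp U V W (A : set U) (g : V -> W) (f : U -> V) :
  open A -> linear g -> continuous g -> Cinf A f -> Cinf A (fun x => g (f x)).
Proof.
move=> oA lg cg cf n; pose lM := GRing.isLinear.Build _ _ _ _ _ lg.
pose L : {linear _ -> _} := HB.pack g lM.
exact: (@Ck_postcomp _ _ _ _ _ L).
Qed.

Lemma Cinf_precomp U V W (A : set V) (g : U -> V) (f : V -> W) :
  open A -> linear g -> continuous g -> Cinf A f ->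
  Cinf (g @^-1` A) (fun x => f (g x)).
Proof.
move=> oA lg cg cf n; pose lM := GRing.isLinear.Build _ _ _ _ _ lg.
pose L : {linear _ -> _} := HB.pack g lM.
exact: (@Ck_precomp _ _ _ _ _ L).
Qed.

Lemma CinfD V W (A : set V) (f g : V -> W) : open A ->
  Cinf A f -> Cinf A g -> Cinf A (fun x => f x + g x).
Proof. by move=> oA cf cg n; exact: CkD. Qed.

Lemma CinfM V (A : set V) (f g : V -> R^o) : open A ->
  Cinf A f -> Cinf A g -> Cinf A (fun x => f x * g x : R^o).
Proof. by move=> oA cf cg n; exact: CkM. Qed.

Lemma CinfV V (A : set V) (f : V -> R^o) : open A ->
  (forall x, A x -> f x != 0) ->
  Cinf A f -> Cinf A (fun x => (f x)^-1 : R^o).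
Proof. by move=> oA f0 cf n; exact: CkV. Qed.

Lemma Cinf_sum V W (A : set V) I (r : seq I) (P : pred I) (f : I -> V -> W) :
  open A -> (forall i, Cinf A (f i)) ->
  Cinf A (fun x => \sum_(i <- r | P i) f i x).
Proof.
move=> oA cf; elim: r => [|i r IH].
  by under eq_fun do rewrite big_nil; exact: Cinf_cst.
under eq_fun do rewrite big_cons.
by case: (P i) => //; exact: CinfD.
Qed.

Lemma Cinf_prod V (A : set V) I (r : seq I) (P : pred I) (f : I -> V -> R^o) :
  open A -> (forall i, Cinf A (f i)) ->
  Cinf A (fun x => \prod_(i <- r | P i) f i x : R^o).
Proof.
move=> oA cf; elim: r => [|i r IH].
  by under eq_fun do rewrite big_nil; exact: Cinf_cst.
under eq_fun do rewrite big_cons.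
by case: (P i) => //; exact: CinfM.
Qed.

(** The pair is the sum of [(f, 0)] and [(0, g)], each the composite of a smooth map with a
    continuous linear injection. *)
Lemma Cinf_pair U V W (A : set U) (f : U -> V) (g : U -> W) : open A ->
  Cinf A f -> Cinf A g -> Cinf A (fun x => (f x, g x) : (V * W)%type).
Proof.
move=> oA cf cg.
have l1 : linear (fun y : V => (y, 0) : (V * W)%type).
  by move=> a y z; congr (_, _) => //=; rewrite scaler0 addr0.
have l2 : linear (fun y : W => (0, y) : (V * W)%type).
  by move=> a y z; congr (_, _) => //=; rewrite scaler0 addr0.
have c1 : continuous (fun y : V => (y, 0) : (V * W)%type).
  by move=> y; apply: cvg_pair => //; exact: cvg_cst.
have c2 : continuous (fun y : W => (0, y) : (V * W)%type).
  by move=> y; apply: cvg_pair => //; exact: cvg_cst.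
apply: Cinf_ext (CinfD oA (Cinf_postcomp oA l1 c1 cf) (Cinf_postcomp oA l2 c2 cg)).
  exact: oA.
by move=> x _; congr (_, _) => /=; rewrite ?addr0 ?add0r.
Qed.

Lemma continuous_mx (T : topologicalType) m n (f : T -> 'M[R]_(m, n)) :
  (forall i j, continuous (fun t => f t i j)) -> continuous f.
Proof.
move=> cf x; apply/cvg_ballP => e e0.
have : \forall t \near x, forall ij : 'I_m * 'I_n,
    ball (f x ij.1 ij.2) e (f t ij.1 ij.2).
  apply: filter_forall => -[i j].
  exact: (cf i j x _ (nbhsx_ballx _ _ e0)).
by apply: filterS => t ft; split=> // i j; exact: (ft (i, j)).
Qed.

Lemma continuous_coord (T : topologicalType) m n (f : T -> 'M[R]_(m, n)) i j :
  continuous f -> continuous (fun t => f t i j).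
Proof.
move=> cf x.
exact: (@continuous_comp _ _ _ f (fun M => M i j) x (cf x)
  (@coord_continuous R m n i j (f x))).
Qed.

(** Expanded in the basis [delta_mx i j], the map is a finite sum of coordinates times fixed
    vectors. *)
Lemma mx_linear_continuous m n W (f : 'M[R]_(m, n) -> W) :
  linear f -> continuous f.
Proof.
move=> lf; pose lM := GRing.isLinear.Build _ _ _ _ _ lf.
pose L : {linear _ -> _} := HB.pack f lM.
have E M : f M = \sum_i \sum_j M i j *: f (delta_mx i j).
  rewrite -[f]/(L : _ -> _) {1}(matrix_sum_delta M) linear_sum.
  by apply: eq_bigr => i _; rewrite linear_sum; apply: eq_bigr => j _; rewrite linearZ.
rewrite (funext E); apply: continuous_big => [|i _]; first exact: add_continuous.
apply: continuous_big => [|j _]; first exact: add_continuous.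
move=> M; apply: cvgZr_tmp; first exact: nbhs_filter.
exact: coord_continuous.
Qed.

Lemma Cinf_mx V (A : set V) m n (f : V -> 'M[R]_(m, n)) : open A ->
  (forall i j, Cinf A (fun x => f x i j : R^o)) -> Cinf A f.
Proof.
move=> oA cf; rewrite (_ : f = fun x => \sum_i \sum_j f x i j *: delta_mx i j).
  apply: Cinf_sum => // i; apply: Cinf_sum => // j.
  apply: (@Cinf_postcomp _ _ _ _ (fun y : R^o => y *: delta_mx i j)) => //.
    by move=> a y z; rewrite scalerDl scalerA.
  exact: scalel_continuous.
by apply/funext => x; exact: matrix_sum_delta.
Qed.

Lemma Cinf_coord V (A : set V) m n (f : V -> 'M[R]_(m, n)) i j : open A ->
  Cinf A f -> Cinf A (fun x => f x i j : R^o).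
Proof.
move=> oA; apply: (@Cinf_postcomp _ _ _ _ (fun M : 'M[R]_(m, n) => M i j : R^o)) => //.
  by move=> a y z; rewrite !mxE.
exact: coord_continuous.
Qed.

Lemma Cinf_mulmx V (A : set V) m n p (f : V -> 'M[R]_(m, n))
    (g : V -> 'M[R]_(n, p)) : open A ->
  Cinf A f -> Cinf A g -> Cinf A (fun x => f x *m g x).
Proof.
move=> oA cf cg; apply: Cinf_mx => // i j; under eq_fun do rewrite mxE.
by apply: Cinf_sum => // l; apply: CinfM => //; exact: Cinf_coord.
Qed.

Lemma Cinf_det V (A : set V) n (f : V -> 'M[R]_n) : open A ->
  Cinf A f -> Cinf A (fun x => \det (f x) : R^o).
Proof.
move=> oA cf; apply: Cinf_sum => // s; apply: CinfM => //; first exact: Cinf_cst.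
by apply: Cinf_prod => // i; exact: Cinf_coord.
Qed.

(** Cramer's formula: the inverse is the adjugate, polynomial in the entries, divided by a
    determinant that does not vanish on [A]. *)
Lemma Cinf_invmx V (A : set V) n (f : V -> 'M[R]_n) : open A ->
  (forall x, A x -> f x \in unitmx) ->
  Cinf A f -> Cinf A (fun x => invmx (f x)).
Proof.
move=> oA uf cf.
apply: (@Cinf_ext _ _ _ (fun x => (\det (f x))^-1 *: \adj (f x))) => //.
  by move=> x Ax; rewrite /invmx uf.
apply: Cinf_mx => // i j; under eq_fun do rewrite !mxE.
apply: CinfM => //.
  by apply: CinfV => //; [move=> x /uf; rewrite unitmxE unitfE|exact: Cinf_det].
rewrite /cofactor; apply: CinfM => //; first exact: Cinf_cst.
apply: Cinf_det => //; apply: Cinf_mx => // i' j'; under eq_fun do rewrite !mxE.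
exact: Cinf_coord.
Qed.

End SmoothCalculus.

(** * Continuity in product and pointwise topologies, and identities passing to closures *)

Section Topology.

Lemma continuous_compose (T U Y : topologicalType) (f : T -> U) (g : U -> Y) :
  continuous f -> continuous g -> continuous (fun x => g (f x)).
Proof. by move=> cf cg x; exact: (@continuous_comp _ _ _ f g x (cf x) (cg _)). Qed.

Lemma within_continuous_compose (T U Y : topologicalType) (X : set T)
    (A : set U) (c : T -> U) (g : U -> Y) :
  continuous c -> (forall x, X x -> A (c x)) -> {within A, continuous g} ->
  {within X, continuous (fun x => g (c x))}.
Proof.
move=> cc XA /(subspace_continuousP A g).1 cg.
apply: (subspace_continuousP X _).2 => x Xx.
apply: cvg_trans (_ : _ --> _) (cg _ (XA _ Xx)) => B; rewrite /fmap /within /= => nB.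
have nxB : nbhs x (c @^-1` [set y | A y -> B (g y)]) := cc x _ nB.
by apply: filterS nxB => x' /= gB /XA /gB.
Qed.

Lemma continuous_fst (T U : topologicalType) : continuous (fun z : T * U => z.1).
Proof. by move=> z; exact: cvg_fst. Qed.

Lemma continuous_snd (T U : topologicalType) : continuous (fun z : T * U => z.2).
Proof. by move=> z; exact: cvg_snd. Qed.

Lemma continuous_pair (T U Y : topologicalType) (f : T -> U) (g : T -> Y) :
  continuous f -> continuous g -> continuous (fun x => (f x, g x)).
Proof. by move=> cf cg x; apply: cvg_pair; [exact: cf|exact: cg]. Qed.

Lemma continuous_eval (I : eqType) (Y : topologicalType) (i : I) :
  continuous (fun f : {ptws I -> Y} => f i).
Proof. exact: proj_continuous. Qed.

(** Any neighbourhoods of [f x] and [g x] have preimages whose intersection meets [A], hence they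
    share a point; the Hausdorff property then identifies the two values. *)
Lemma eq_closure (T Y : topologicalType) (f g : T -> Y) (A : set T) :
  hausdorff_space Y -> continuous f -> continuous g ->
  (forall x, A x -> f x = g x) -> forall x, closure A x -> f x = g x.
Proof.
move=> hY cf cg fg x clx; apply: hY => B C fB gC.
have nBC : nbhs x (f @^-1` B `&` g @^-1` C) by apply: filterI; [exact: cf|exact: cg].
have [y [Ay [By Cy]]] := clx _ nBC.
by exists (f y); split => //; rewrite fg.
Qed.

(** The pointwise topology is the supremum of the topologies induced by the evaluations. *)
Lemma continuous_ptws (T : topologicalType) (I : eqType) (Y : topologicalType)
  (f : T -> {ptws I -> Y}) :
  (forall i, continuous (fun x => f x i)) -> continuous f.
Proof.
move=> cf x; apply/cvg_sup => i W [V [[B oB <-] Bfx] VW].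
apply: (filterS VW); apply: (cf i x); exact: open_nbhs_nbhs.
Qed.

Lemma continuous_sumr (R : realType) (T : topologicalType) I (r : seq I)
    (f : I -> T -> R) :
  (forall i, continuous (f i)) -> continuous (fun x => \sum_(i <- r) f i x).
Proof. by move=> cf; apply: continuous_big => //; exact: add_continuous. Qed.

Lemma continuous_addr (R : realType) (T : topologicalType) (f g : T -> R) :
  continuous f -> continuous g -> continuous (fun x => f x + g x).
Proof.
move=> cf cg x.
exact: (@continuousD R R^o T f g x (cf x) (cg x)).
Qed.

Lemma continuous_mulr (R : realType) (T : topologicalType) (f g : T -> R) :
  continuous f -> continuous g -> continuous (fun x => f x * g x).
Proof. by move=> cf cg x; apply: continuousM; [exact: cf|exact: cg]. Qed.

End Topology.

(** * Smoothness on arbitrary subsets from a single smooth extension *)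

Section SmoothOn.
Variable R : realType.
Implicit Types U V W : normedModType R.

Lemma Cinf_smooth_on V W (A X : set V) (f g : V -> W) :
  open A -> X `<=` A -> Cinf A g -> (forall x, X x -> g x = f x) ->
  smooth_on X f.
Proof.
move=> oA XA cg gf x Xx; exists A, g; split => //; first by split=> //; exact: XA.
by move=> y /gf.
Qed.

Lemma Cinf_continuous V W (f : V -> W) : Cinf setT f -> continuous f.
Proof. by move=> cf x; exact: (cf 0). Qed.

Lemma Cinf_fst V W (A : set (V * W)%type) : Cinf A (fun z => z.1).
Proof. by apply: Cinf_linear => //; exact: continuous_fst. Qed.

Lemma Cinf_snd V W (A : set (V * W)%type) : Cinf A (fun z => z.2).
Proof. by apply: Cinf_linear => //; exact: continuous_snd. Qed.

End SmoothOn.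

(** * Configurations and congruence *)

Section Euclidean.
Variables (R : realType) (k : nat).
Implicit Types (v w : 'rV[R]_k) (A : 'M[R]_k).

Lemma dotE v w : dot v w = (v *m w^T) 0 0.
Proof. by rewrite mxE; apply: eq_bigr => j _; rewrite mxE. Qed.

Lemma dot_ge0 v : 0 <= dot v v.
Proof. by apply: sumr_ge0 => j _; rewrite -expr2 sqr_ge0. Qed.

Lemma dotvv_eq0 v : (dot v v == 0) = (v == 0).
Proof.
apply/eqP/eqP => [/psumr_eq0P v0|->].
  apply/rowP => j; rewrite mxE; apply/eqP; rewrite -[_ == 0]sqrf_eq0 expr2.
  by rewrite v0// => i _; rewrite -expr2 sqr_ge0.
by rewrite /dot big1// => j _; rewrite mxE mul0r.
Qed.

Lemma dotC v w : dot v w = dot w v.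
Proof. by apply: eq_bigr => j _; rewrite mulrC. Qed.

Lemma dotDl u v w : dot (u + v) w = dot u w + dot v w.
Proof. by rewrite -big_split; apply: eq_bigr => j _; rewrite mxE mulrDl. Qed.

Lemma dotZl a v w : dot (a *: v) w = a * dot v w.
Proof. by rewrite /dot mulr_sumr; apply: eq_bigr => j _; rewrite mxE mulrA. Qed.

Lemma dotBl u v w : dot (u - v) w = dot u w - dot v w.
Proof. by rewrite -scaleN1r dotDl dotZl mulN1r. Qed.

Lemma dot_suml I (r : seq I) (P : pred I) (f : I -> 'rV[R]_k) w :
  dot (\sum_(i <- r | P i) f i) w = \sum_(i <- r | P i) dot (f i) w.
Proof.
rewrite !dotE mulmx_suml summxE; by under [RHS]eq_bigr do rewrite dotE.
Qed.

Lemma enorm_ge0 v : 0 <= enorm v. Proof. exact: sqrtr_ge0. Qed.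

Lemma enorm_sqr v : enorm v ^+ 2 = dot v v.
Proof. by rewrite sqr_sqrtr// dot_ge0. Qed.

Lemma enorm_eq0 v : (enorm v == 0) = (v == 0).
Proof. by rewrite -[LHS]sqrf_eq0 enorm_sqr dotvv_eq0. Qed.

Lemma enorm_gt0 v : (0 < enorm v) = (v != 0).
Proof. by rewrite lt_neqAle enorm_ge0 andbT eq_sym enorm_eq0. Qed.

Lemma enormN v : enorm (- v) = enorm v.
Proof. by congr Num.sqrt; apply: eq_bigr => j _; rewrite !mxE mulrNN. Qed.

Lemma enorm_distC v w : enorm (v - w) = enorm (w - v).
Proof. by rewrite -enormN opprB. Qed.

Lemma dot_polarization v w :
  dot v w = (enorm v ^+ 2 + enorm w ^+ 2 - enorm (v - w) ^+ 2) / 2.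
Proof.
rewrite !enorm_sqr dotBl ![dot _ (v - w)]dotC !dotBl (dotC w v).
by field.
Qed.

Lemma dot_mulmx A v w : orthogonal_group A -> dot (v *m A) (w *m A) = dot v w.
Proof. by move=> OA; rewrite !dotE trmx_mul mulmxA -(mulmxA v) OA mulmx1. Qed.

Lemma enorm_mulmx A v : orthogonal_group A -> enorm (v *m A) = enorm v.
Proof. by move=> OA; rewrite /enorm dot_mulmx. Qed.

Lemma orthogonal_unit A : orthogonal_group A -> A \in unitmx.
Proof. by case/mulmx1_unit. Qed.

End Euclidean.

(** * Configurations under isometries and scaling, normalization, injectivity of the coordinates *)

Section Configurations.
Variables (R : realType) (k n : nat).
Implicit Types (u v : 'M[R]_(n, k)) (i j l a b : 'I_n) (A : 'M[R]_k).

Lemma dist_gt0 u i j : config u -> i != j -> 0 < enorm (row i u - row j u).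
Proof. by move=> cu ij; rewrite enorm_gt0 subr_eq0 cu. Qed.

Lemma enorm_direction u i j : config u -> i != j -> enorm (direction u i j) = 1.
Proof.
move=> cu ij; have u0 := dist_gt0 cu ij.
by rewrite enormZ ?invr_ge0 ?ltW// mulVf ?gt_eqF.
Qed.

Lemma scale_direction u i j :
  enorm (row i u - row j u) *: direction u i j = row i u - row j u.
Proof.
rewrite scalerA; have [/eqP|u0] := eqVneq (enorm (row i u - row j u)) 0.
  by rewrite enorm_eq0 => /eqP ->; rewrite scaler0.
by rewrite mulfV// scale1r.
Qed.

Lemma direction_mulmx u A i j : orthogonal_group A ->
  direction (u *m A) i j = direction u i j *m A.
Proof. by move=> OA; rewrite /direction !row_mul -mulmxBl enorm_mulmx// scalemxAl. Qed.

Lemma ratio_mulmx u A i j l : orthogonal_group A ->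
  ratio (u *m A) i j l = ratio u i j l.
Proof. by move=> OA; rewrite /ratio !row_mul -!mulmxBl !enorm_mulmx. Qed.

Lemma config_mulmx u A : orthogonal_group A -> config u -> config (u *m A).
Proof.
move=> OA cu i j ij; rewrite !row_mul; apply: contra (cu i j ij) => /eqP.
by move/(congr1 (mulmx^~ (invmx A))); rewrite !mulmxK ?orthogonal_unit// => ->.
Qed.

Lemma ratio_place x (t : R) u i j l : 0 < t ->
  ratio (place x t u) i j l = ratio u i j l.
Proof.
move=> t0; rewrite /ratio !place_rowB !enormZ ?ltW//.
by rewrite -mulf_div divff ?gt_eqF// mul1r.
Qed.

Lemma config_place x (t : R) u : 0 < t -> config (place x t u) <-> config u.
Proof.
move=> t0; have E i j : (row i (place x t u) != row j (place x t u)) =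
    (row i u != row j u).
  by rewrite -subr_eq0 place_rowB scaler_eq0 gt_eqF//= subr_eq0.
by split=> cu i j /cu; rewrite E.
Qed.

Lemma row_place x (t : R) u i : row i (place x t u) = x + t *: row i u.
Proof. by apply/rowP => j; rewrite !mxE. Qed.

(* The quotient of corresponding distances is the same for two pairs with a
   common point, and any two pairs are joined through such pairs. *)
Lemma ratio_proportional u v a b : a != b -> config u -> config v ->
  (forall i j l, uniq [:: i; j; l] -> ratio u i j l = ratio v i j l) ->
  exists2 c, 0 < c & forall i j,
    enorm (row i u - row j u) = c * enorm (row i v - row j v).
Proof.
move=> ab cu cv uv.
pose q i j := enorm (row i u - row j u) / enorm (row i v - row j v).
have qC i j : q i j = q j i.
  by rewrite /q enorm_distC [X in _ / X]enorm_distC.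
have q_common i j l : i != j -> i != l -> q i j = q i l.
  move=> ij il; have [<-//|jl] := eqVneq j l.
  have : ratio u i j l = ratio v i j l by apply: uv; rewrite /= !inE negb_or ij il jl.
  have := dist_gt0 cu il; have := dist_gt0 cv il; have := dist_gt0 cv ij.
  rewrite /ratio /q => /gt_eqF/negbT v1 /gt_eqF/negbT v2 /gt_eqF/negbT u2.
  move/eqP; rewrite eqr_div// => /eqP E; apply/eqP; rewrite eqr_div//.
  by rewrite E mulrC.
have qab i j : i != j -> q i j = q a b.
  move=> ij; have [ia|ia] := eqVneq i a; first by rewrite ia in ij *; exact: q_common.
  by rewrite (q_common i j a)// qC; apply: q_common; rewrite // eq_sym.
exists (q a b); first by rewrite divr_gt0 ?dist_gt0.
move=> i j; have [->|ij] := eqVneq i j; first by rewrite !subrr -(scale0r 0) enormZ// mul0r mulr0.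
by rewrite -(qab i j ij) /q divfK// gt_eqF// dist_gt0.
Qed.

Definition normalized u :=
  \sum_i row i u = 0 /\ \sum_i enorm (row i u) ^+ 2 = 1.

Lemma normalized_mulmx u A : orthogonal_group A -> normalized u ->
  normalized (u *m A).
Proof.
move=> OA [u0 u1]; split.
  by under eq_bigr do rewrite row_mul; rewrite -mulmx_suml u0 mul0mx.
by under eq_bigr do rewrite row_mul enorm_mulmx//.
Qed.

(** Summing over [j] eliminates the centroids and leaves [u_i = c v_i]; comparing the sums of
    squared norms gives [c ^+ 2 = 1], so [c = 1] by positivity. *)
Lemma normalized_eq u v c : 0 < c -> normalized u -> normalized v ->
  (forall i j, row i u - row j u = c *: (row i v - row j v)) -> u = v.
Proof.
move=> c0 [u0 u1] [v0 v1] uv.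
(* For [n = 0] the sum of squared norms would be empty, hence 0 instead of 1. *)
have n0 : (n%:R : R) != 0.
  rewrite pnatr_eq0; apply: contra_eq_neq u1 => n0.
  rewrite big1 ?(eq_sym 0) ?oner_neq0// => i _.
  by exfalso; move: (leq_ltn_trans (leq0n i) (ltn_ord i)); rewrite n0.
have uE i : row i u = c *: row i v.
  have : \sum_j (row i u - row j u) = c *: \sum_j (row i v - row j v).
    by rewrite scaler_sumr; apply: eq_bigr => j _.
  rewrite !sumrB u0 v0 !subr0 !sumr_const card_ord.
  rewrite -(scaler_nat n (row i u)) -(scaler_nat n (row i v)) scalerA mulrC -scalerA.
  exact: (scalerI n0).
have c1 : c = 1.
  apply/eqP; rewrite -(@eqrXn2 _ 2)// ?ltW// expr1n -u1; apply/eqP.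
  by under [RHS]eq_bigr do rewrite uE enormZ ?ltW// exprMn; rewrite -mulr_sumr v1 mulr1.
by apply/row_matrixP => i; rewrite uE c1 scale1r.
Qed.

Lemma normalize u a b : a != b -> config u -> exists (x : 'rV[R]_k) (t : R) v,
  [/\ 0 < t, normalized v, config v & u = place x t v].
Proof.
move=> ab cu; pose x := n%:R^-1 *: \sum_i row i u.
pose s := \sum_i enorm (row i u - x) ^+ 2.
have n0 : (n%:R : R) != 0 by rewrite pnatr_eq0 -lt0n (leq_ltn_trans _ (ltn_ord a)).
(* If [s] vanished, every point would equal the centroid, although points [a] and [b] are
   distinct. *)
have s0 : 0 < s.
  rewrite lt_neqAle sumr_ge0 ?andbT => [|i _]; last by rewrite sqr_ge0.
  apply: contra (cu a b ab) => /eqP/esym/psumr_eq0P E.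
  have ux i : row i u = x.
    apply/eqP; rewrite -subr_eq0 -enorm_eq0 -[_ == 0]sqrf_eq0 E// => j _.
    exact: sqr_ge0.
  by rewrite !ux.
have t0 : 0 < Num.sqrt s by rewrite sqrtr_gt0.
(* Centring at [x] and dividing by [Num.sqrt s] is again a map of the form [place], so its rows can
   be computed by [row_place]. *)
pose v := place (- ((Num.sqrt s)^-1 *: x)) (Num.sqrt s)^-1 u.
have vE i : row i v = (Num.sqrt s)^-1 *: (row i u - x).
  by rewrite row_place scalerBr addrC.
have uE : u = place x (Num.sqrt s) v.
  apply/row_matrixP => i; rewrite row_place vE scalerA mulfV ?gt_eqF// scale1r.
  by rewrite addrC subrK.
exists x, (Num.sqrt s), v; split => //; last by apply/(config_place x v t0); rewrite -uE.
split.
  under eq_bigr do rewrite vE.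
  rewrite -scaler_sumr sumrB sumr_const card_ord -scaler_nat /x scalerA mulfV//.
  by rewrite scale1r subrr scaler0.
under eq_bigr do rewrite vE enormZ ?invr_ge0 ?ltW// exprMn.
by rewrite -mulr_sumr -/s exprVn sqr_sqrtr ?ltW// mulVf ?gt_eqF.
Qed.

Lemma centroid_place x (t : R) u : normalized u ->
  \sum_i row i (place x t u) = n%:R *: x.
Proof.
move=> [u0 _]; under eq_bigr do rewrite row_place.
by rewrite big_split /= -scaler_sumr u0 scaler0 addr0 sumr_const card_ord -scaler_nat.
Qed.

(** The ratios determine the distances up to one common factor, the directions then determine the
    edge vectors up to that factor, and normalization fixes it. *)
Lemma directions_inj u v a b : a != b ->
  config u -> config v -> normalized u -> normalized v ->
  directions u = directions v -> ratios u = ratios v -> u = v.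
Proof.
move=> ab cu cv nu nv dd rr.
have [|c c0 uv] := ratio_proportional ab cu cv.
  move=> i j l ijl; have := congr1 (fun f => f (exist _ (i, j, l) ijl)) rr.
  by case.
apply: (normalized_eq c0) => // i j.
have [->|ij] := eqVneq i j; first by rewrite !subrr scaler0.
rewrite -(scale_direction u) -(scale_direction v) uv -scalerA; congr (_ *: (_ *: _)).
exact: (congr1 (fun f => f (exist (fun ij => ij.1 != ij.2) (i, j) ij)) dd).
Qed.

(** This includes the face [t = 0]: [u] comes from directions and ratios alone, [x] is the centroid,
    and [t >= 0] follows from [t ^+ 2 = \sum_i enorm (t *: row i u) ^+ 2]. *)
Lemma collar_inj a b (z z' : collar_space R k n) : a != b ->
  collar_dom z -> collar_dom z' -> collar z = collar z' -> z = z'.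
Proof.
move: z z' => [[x t] u] [[y s] v] /= ab [/= t0 cu u0 u1] [/= s0 cv v0 v1] [E dd rr].
have n0 : (n%:R : R) != 0 by rewrite pnatr_eq0 -lt0n (leq_ltn_trans _ (ltn_ord a)).
have nu : normalized u by split.
have nv : normalized v by split.
have uv : u = v by exact: (directions_inj ab cu cv nu nv dd rr).
have xy : x = y.
  apply: (scalerI n0); rewrite -(centroid_place x t nu) -(centroid_place y s nv).
  by apply: eq_bigr => i _; rewrite E.
rewrite xy uv; congr (_, _, _); apply/eqP; rewrite -(@eqrXn2 _ 2)//.
rewrite -[t ^+ 2]mulr1 -[s ^+ 2]mulr1 -{1}u1 -v1 !mulr_sumr; apply/eqP/eq_bigr => i _.
rewrite -!exprMn -!enormZ//; congr (enorm _ ^+ 2).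
by apply: (addrI x); rewrite -row_place E row_place xy.
Qed.

End Configurations.

(** * Edge matrices, and similarity of normalized simplices through Gram matrices *)

Section Edges.
Variables (R : realType) (k : nat).
Implicit Types (u v : 'M[R]_(k.+1, k)) (A : 'M[R]_k).

Definition edges u : 'M[R]_k := \matrix_i (row (lift ord0 i) u - row ord0 u).

Lemma edges_mulmx u A : edges (u *m A) = edges u *m A.
Proof. by apply/row_matrixP => i; rewrite row_mul !rowK !row_mul mulmxBl. Qed.

(** A nonzero [v] orthogonal to all edges has the same product with every vertex, so one hyperplane
    with normal [v] would contain all [k + 1] vertices. *)
Lemma edges_unit p : nondegenerate_simplex p -> edges p \in unitmx.
Proof.
move=> [_ hp]; rewrite unitmxE unitfE -det_tr; apply/negP => /det0P[v v0 vp].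
have vE i : dot v (row i p) = dot v (row ord0 p).
  case: (unliftP ord0 i) => [j|] -> //.
  apply/eqP; rewrite -subr_eq0 !(dotC v) -dotBl dotC; apply/eqP.
  have := congr1 (fun M : 'rV_k => M 0 j) vp; rewrite !mxE => <-.
  by apply: eq_bigr => l _; rewrite !mxE.
have := hp v (dot v (row ord0 p)) v0.
by rewrite (eq_card (_ : _ =i predT)) ?card_ord ?ltnn// => i; rewrite !inE vE eqxx.
Qed.

Lemma edges_place x (t : R) u : edges (place x t u) = t *: edges u.
Proof. by apply/row_matrixP => i; rewrite !rowK place_rowB linearZ /= rowK. Qed.

Lemma congruence u v : (0 < k)%N -> edges u \in unitmx ->
  config u -> config v -> normalized u -> normalized v ->
  (forall i j l, uniq [:: i; j; l] -> ratio v i j l = ratio u i j l) ->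
  exists2 A, orthogonal_group A & v = u *m A.
Proof.
move=> k0 Pu cu cv nu nv uv.
(* Since [k > 0] there are two distinct vertices, whose distances define the common factor [c]. *)
have ab : ord0 != ord_max :> 'I_k.+1 by rewrite -val_eqE /= eq_sym -lt0n.
have [c c0 vE] := ratio_proportional ab cv cu uv.
have gram : edges v *m (edges v)^T = c ^+ 2 *: (edges u *m (edges u)^T).
  have gramE w i j : (edges w *m (edges w)^T) i j =
      dot (row (lift ord0 i) w - row ord0 w) (row (lift ord0 j) w - row ord0 w).
    by rewrite mxE; apply: eq_bigr => l _; rewrite !mxE.
  (* Polarization expresses each Gram entry through three distances between vertices, all of which
     scale by [c]. *)
  apply/matrixP => i j; rewrite [RHS]mxE !gramE !dot_polarization.
  have subB (x y z : 'rV[R]_k) : x - z - (y - z) = x - y by rewrite opprB addrA subrK.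
  by rewrite !subB !vE !exprMn -mulrDr -mulrBr mulrA.
(* This is the only matrix with [edges v = c *: (edges u *m A)]; proportional Gram matrices make it
   orthogonal, and [normalized_eq] later removes [c]. *)
pose A := c^-1 *: (invmx (edges u) *m edges v).
have OA : orthogonal_group A.
  rewrite /orthogonal_group /= /A linearZ /= -scalemxAl -scalemxAr scalerA.
  rewrite trmx_mul mulmxA -(mulmxA _ (edges v)) gram -scalemxAr -scalemxAl scalerA.
  rewrite mulmxA mulVmx// mul1mx -trmx_mul mulVmx// trmx1.
  by rewrite -expr2 -exprMn mulVf ?gt_eqF// expr1n scale1r.
exists A => //; apply: (normalized_eq c0) => //; first exact: normalized_mulmx.
have vA : edges v = c *: edges (u *m A).
  by rewrite edges_mulmx -scalemxAr scalerA mulfV ?gt_eqF// scale1r mulmxA mulmxV// mul1mx.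
have v0 i : row i v - row ord0 v = c *: (row i (u *m A) - row ord0 (u *m A)).
  case: (unliftP ord0 i) => [j|] ->; last by rewrite !subrr scaler0.
  by have := congr1 (row j) vA; rewrite linearZ /= !rowK.
(* An arbitrary edge is the difference of two edges at vertex 0. *)
move=> i j; rewrite -[row i v](subrK (row ord0 v)) -addrA -opprB opprB.
by rewrite -(opprB (row j v)) v0 (v0 j) -scalerBr opprB addrA subrK.
Qed.

End Edges.

(** * The parametrization of Sim *)

Section Parametrization.
Variables (R : realType) (k : nat) (u : 'M[R]_(k.+1, k)).
Hypotheses (hk : (0 < k)%N) (cu : config u) (nu : normalized u).
Hypothesis Pu : edges u \in unitmx.

Local Notation amb := (ambient R k k.+1).
Local Notation V0 := ('M[R]_k * R^o * 'rV[R]_k)%type.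

Lemma lift0_neq (i : 'I_k) : lift ord0 i != ord0 :> 'I_k.+1.
Proof. by rewrite eq_sym neq_lift. Qed.

Definition edge_pair (i : 'I_k) : dpairs k.+1 :=
  exist (fun ij => ij.1 != ij.2) (lift ord0 i, ord0) (lift0_neq i).

Definition rotate (z : V0) : collar_space R k k.+1 := (z.2, z.1.2, u *m z.1.1).

(** When [d] holds the directions of [u *m A], rescaling by the edge lengths of [u] rebuilds
    [edges u *m A], so the result is [A]. The formula is linear in [d] and does not involve the size
    of the configuration. *)
Definition frame (d : {ptws dpairs k.+1 -> 'rV[R]_k}) : 'M[R]_k :=
  invmx (edges u) *m \matrix_i
    (enorm (row (lift ord0 i) u - row ord0 u) *: d (edge_pair i)).

(** The middle component recovers [t] by projection: for [q_i = x + t u_i A] the terms in [x] cancel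
    as [\sum_i u_i = 0], and the rest sums to [t]. No division by [t] occurs, so the formula is also
    valid on the face. *)
Definition unrotate (z : amb) : V0 :=
  (frame z.1.2, \sum_i dot (row i z.1.1) (row i u *m frame z.1.2),
   k.+1%:R^-1 *: \sum_i row i z.1.1).

Lemma rotate_dom z : model z -> collar_dom (rotate z).
Proof.
move=> [OA t0]; have [s0 s1] := normalized_mulmx OA nu.
by split=> //; exact: config_mulmx.
Qed.

(** On [model] the directions of [u *m A] are those of [u] times [A]; the right-hand side is
    polynomial in [z], hence continuous on the whole vector space. *)
Lemma collar_rotate z : model z -> collar (rotate z) =
  (place z.2 z.1.2 (u *m z.1.1),
   (fun ij => direction u (val ij).1 (val ij).2 *m z.1.1) : {ptws dpairs k.+1 -> 'rV[R]_k},
   ratios u).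
Proof.
move=> [OA _]; congr (_, _, _).
  by apply/funext => ij; exact: direction_mulmx.
by apply/funext => ijl; rewrite /ratios ratio_mulmx.
Qed.

Lemma rotateK z : model z -> unrotate (collar (rotate z)) = z.
Proof.
move=> mz; rewrite collar_rotate// /unrotate /=.
case: z mz => -[A t] x /= [OA t0].
have -> : frame (fun ij => direction u (val ij).1 (val ij).2 *m A) = A.
  rewrite /frame [X in _ *m X](_ : _ = edges u *m A) ?mulKmx//.
  apply/row_matrixP => i; rewrite row_mul !rowK /= scalemxAl.
  by rewrite scale_direction.
have [s0 s1] := normalized_mulmx OA nu.
congr (_, _, _); last by rewrite centroid_place// scalerA mulVf ?scale1r ?pnatr_eq0.
under eq_bigr do rewrite row_place row_mul dotDl dotZl -[X in _ + t * X]enorm_sqr -row_mul dotC.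
by rewrite big_split /= -dot_suml s0 -mulr_sumr s1 mulr1 -(scale0r 0) dotZl mul0r add0r.
Qed.

Lemma frame_continuous (T : topologicalType)
    (d : T -> {ptws dpairs k.+1 -> 'rV[R]_k}) :
  (forall ij, continuous (fun t => d t ij)) -> continuous (fun t => frame (d t)).
Proof.
move=> cd.
have cl : continuous (mulmx (invmx (edges u)) : 'M[R]_k -> 'M[R]_k).
  by apply: mx_linear_continuous => a v w; rewrite linearP.
suff cm : continuous (fun t => \matrix_i
    (enorm (row (lift ord0 i) u - row ord0 u) *: d t (edge_pair i))).
  exact: continuous_compose cm cl.
apply: continuous_mx => i j; under eq_fun do rewrite !mxE.
move: (enorm _) => c; apply: continuous_mulr; first exact: cst_continuous.
by apply: continuous_coord.
Qed.

Lemma dot_sum_continuous (T : topologicalType) (q : T -> 'M[R]_(k.+1, k))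
    (A : T -> 'M[R]_k) : continuous q -> continuous A ->
  continuous (fun t => \sum_i dot (row i (q t)) (row i u *m A t)).
Proof.
move=> cq cA; apply: continuous_sumr => i; apply: continuous_sumr => j.
under eq_fun do rewrite !mxE; apply: continuous_mulr.
  exact: continuous_coord.
apply: continuous_sumr => l; apply: continuous_mulr; first exact: cst_continuous.
exact: continuous_coord.
Qed.

Lemma centroid_continuous (T : topologicalType) (q : T -> 'M[R]_(k.+1, k)) :
  continuous q -> continuous (fun t => k.+1%:R^-1 *: \sum_i row i (q t)).
Proof.
move=> cq.
have cl : continuous (fun M : 'M[R]_(k.+1, k) => k.+1%:R^-1 *: \sum_i row i M).
  apply: mx_linear_continuous => a v w.
  under eq_bigr do rewrite linearP.
  by rewrite big_split -scaler_sumr linearP.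
exact: (continuous_compose cq cl).
Qed.

Lemma unrotate_continuous : continuous unrotate.
Proof.
have c1 : continuous (fun z : amb => z.1) by exact: continuous_fst.
have cq : continuous (fun z : amb => z.1.1).
  exact: (continuous_compose c1 (@continuous_fst _ _)).
have cd : continuous (fun z : amb => z.1.2).
  exact: (continuous_compose c1 (@continuous_snd _ _)).
have cf : continuous (fun z : amb => frame z.1.2).
  apply: frame_continuous => ij.
  exact: (continuous_compose cd (@continuous_eval _ _ ij)).
exact: (continuous_pair (continuous_pair cf (dot_sum_continuous cq cf))
  (centroid_continuous cq)).
Qed.

Lemma rotate_Cinf (A : set V0) : open A -> Cinf A rotate.
Proof.
move=> oA; apply: Cinf_pair => //.
  apply: Cinf_pair => //; first exact: Cinf_snd.
  apply: (@Cinf_postcomp _ _ _ _ _ snd) => //; last exact: Cinf_fst.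
  exact: continuous_snd.
apply: Cinf_mulmx => //; first exact: Cinf_cst.
apply: (@Cinf_postcomp _ _ _ _ _ fst) => //; last exact: Cinf_fst.
exact: continuous_fst.
Qed.


Lemma rotate_linear : linear rotate.
Proof.
by move=> a y z; congr (_, _, _); rewrite /= mulmxDr -scalemxAr.
Qed.

Lemma rotate_continuous : continuous rotate.
Proof. by have := rotate_Cinf openT; apply: Cinf_continuous. Qed.

(** A linear left inverse of [rotate], expressing [unrotate] in the smooth coordinates over the
    image of [model]. *)
Definition unrotate_coord (z : collar_space R k k.+1) : V0 :=
  (invmx (edges u) *m edges z.2, z.1.2, z.1.1).

Lemma invmx_edges_linear : linear (fun v : 'M[R]_(k.+1, k) => invmx (edges u) *m edges v).
Proof.
move=> a v w; rewrite -linearP; congr (_ *m _).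
by apply/matrixP => i j; rewrite !mxE opprD addrACA -mulrBr.
Qed.

Lemma unrotate_coord_linear : linear unrotate_coord.
Proof. by move=> a y z; congr (_, _, _); exact: invmx_edges_linear. Qed.

Lemma unrotate_coord_Cinf (A : set (collar_space R k k.+1)) : open A ->
  Cinf A unrotate_coord.
Proof.
move=> oA; have c1 : Cinf A (fun z : collar_space R k k.+1 => z.1).
  exact: Cinf_fst.
apply: Cinf_pair => //; last first.
  apply: (@Cinf_postcomp _ _ _ _ _ fst) => //; exact: continuous_fst.
apply: Cinf_pair => //; last first.
  apply: (@Cinf_postcomp _ _ _ _ _ snd) => //; exact: continuous_snd.
apply: (@Cinf_postcomp _ _ _ _ _ (fun v => invmx (edges u) *m edges v)) => //.
- exact: invmx_edges_linear.
- exact/mx_linear_continuous/invmx_edges_linear.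
- exact: Cinf_snd.
Qed.

Lemma unrotate_coord_continuous : continuous unrotate_coord.
Proof. by have := unrotate_coord_Cinf openT; apply: Cinf_continuous. Qed.

(** By injectivity of [collar], coordinates of a point of the image are themselves of the form
    [rotate w], and both sides equal [w]. *)
Lemma unrotate_collar z : collar_dom z ->
  ((@collar R k k.+1 \o rotate) @` @model R k) (collar z) ->
  unrotate (collar z) = unrotate_coord z.
Proof.
move=> Dz [w mw /= Ew].
have ab : ord0 != ord_max :> 'I_k.+1 by rewrite -val_eqE /= eq_sym -lt0n.
rewrite -(collar_inj ab (rotate_dom mw) Dz Ew) rotateK// /unrotate_coord /= edges_mulmx mulKmx//.
by case: w {mw Ew} => -[].
Qed.

Lemma place_rotate_continuous :
  continuous (fun z : V0 => place z.2 z.1.2 (u *m z.1.1)).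
Proof.
have cA : continuous (fun z : V0 => z.1.1).
  exact: (continuous_compose (@continuous_fst _ _) (@continuous_fst _ _)).
have ct : continuous (fun z : V0 => z.1.2).
  exact: (continuous_compose (@continuous_fst _ _) (@continuous_snd _ _)).
have cx : continuous (fun z : V0 => z.2) by exact: continuous_snd.
apply: continuous_mx => i j; under eq_fun do rewrite !mxE.
have cxj := continuous_coord (i := ord0) (j := j) cx.
apply: continuous_addr => //; apply: continuous_mulr => //.
apply: continuous_sumr => l; apply: continuous_mulr; first exact: cst_continuous.
exact: continuous_coord.
Qed.

Lemma direction_rotate_continuous (ij : dpairs k.+1) :
  continuous (fun z : V0 => direction u (val ij).1 (val ij).2 *m z.1.1).
Proof.
have cA : continuous (fun z : V0 => z.1.1).
  exact: (continuous_compose (@continuous_fst _ _) (@continuous_fst _ _)).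
apply: (continuous_compose cA).
by apply: mx_linear_continuous => a v w; exact: linearP.
Qed.

Lemma collar_rotate_continuous :
  {within @model R k, continuous (@collar R k k.+1 \o rotate)}.
Proof.
pose F' (z : V0) : amb := (place z.2 z.1.2 (u *m z.1.1),
   (fun ij => direction u (val ij).1 (val ij).2 *m z.1.1) : {ptws dpairs k.+1 -> 'rV[R]_k},
   ratios u).
have cF : continuous F'.
  apply: continuous_pair; last by move=> z; exact: cvg_cst.
  apply: continuous_pair; first exact: place_rotate_continuous.
  by apply: continuous_ptws => ij; exact: direction_rotate_continuous.
apply: (@subspace_eq_continuous _ _ _ F'); last exact: continuous_subspaceT.
by move=> z; rewrite inE => mz; apply/esym; exact: collar_rotate.
Qed.

(** On the image, [unrotate] takes values in [model] and is inverted by [collar \o rotate]. Written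
    as equalities of continuous maps, these facts pass to the closure of [B]. *)
Lemma closure_rotate (B : set amb) :
  B `<=` (@collar R k k.+1 \o rotate) @` @model R k ->
  closure B `<=` (@collar R k k.+1 \o rotate) @` @model R k.
Proof.
move=> BF z clz.
have c1 : continuous (fun z : amb => z.1) by exact: continuous_fst.
have cq : continuous (fun z : amb => z.1.1).
  exact: (continuous_compose c1 (@continuous_fst _ _)).
have cd : continuous (fun z : amb => z.1.2).
  exact: (continuous_compose c1 (@continuous_snd _ _)).
have cr : continuous (fun z : amb => z.2) by exact: continuous_snd.
have cU := unrotate_continuous.
have cUA : continuous (fun z : amb => (unrotate z).1.1).
  exact: (continuous_compose cU
    (continuous_compose (@continuous_fst _ _) (@continuous_fst _ _))).
have cUt : continuous (fun z : amb => (unrotate z).1.2).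
  exact: (continuous_compose cU
    (continuous_compose (@continuous_fst _ _) (@continuous_snd _ _))).
have BE y : B y -> [/\ model (unrotate y),
    place (unrotate y).2 (unrotate y).1.2 (u *m (unrotate y).1.1) = y.1.1,
    forall ij, direction u (val ij).1 (val ij).2 *m (unrotate y).1.1 = y.1.2 ij
    & ratios u = y.2].
  move=> /BF[w mw yE]; have {yE} <- : collar (rotate w) = y by [].
  by rewrite rotateK// collar_rotate.
have mz : model (unrotate z).
  split.
    apply: (@eq_closure _ _ (fun y => (unrotate y).1.1 *m ((unrotate y).1.1)^T)
      (fun=> 1%:M) B) => //.
    - apply: continuous_mx => i j; under eq_fun do rewrite mxE.
      apply: continuous_sumr => l; under eq_fun do rewrite [_^T _ _]mxE.
      by apply: continuous_mulr; exact: (continuous_coord cUA).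
    - exact: cst_continuous.
    - by move=> y /BE[[]].
  (* The inequality [0 <= t] is restated as the equation [|t| = t], to which [eq_closure]
     applies. *)
  have <- : `|(unrotate z).1.2| = (unrotate z).1.2; last exact: normr_ge0.
  apply: (@eq_closure _ _ (fun y => `|(unrotate y).1.2|)
      (fun y => (unrotate y).1.2) B) => //.
  - exact: (continuous_compose cUt (@norm_continuous _ R^o)).
  - by move=> y /BE[[_ t0] _ _ _]; exact: ger0_norm.
have Eq : place (unrotate z).2 (unrotate z).1.2 (u *m (unrotate z).1.1) = z.1.1.
  apply: (@eq_closure _ _ (fun y => place (unrotate y).2 (unrotate y).1.2
    (u *m (unrotate y).1.1)) (fun y => y.1.1) B) => //.
    exact: (continuous_compose cU place_rotate_continuous).
  by move=> y /BE[].
have Ed ij : direction u (val ij).1 (val ij).2 *m (unrotate z).1.1 = z.1.2 ij.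
  apply: (@eq_closure _ _ (fun y => direction u (val ij).1 (val ij).2 *m
    (unrotate y).1.1) (fun y => y.1.2 ij) B) => //.
  - exact: (continuous_compose cU (@direction_rotate_continuous ij)).
  - exact: (continuous_compose cd (@continuous_eval _ _ ij)).
  - by move=> y /BE[].
have Er ijl : ratios u ijl = z.2 ijl.
  apply: (@eq_closure amb _ (fun=> ratios u ijl) (fun y => y.2 ijl) B) => //.
  - exact: cst_continuous.
  - exact: (continuous_compose cr (@continuous_eval _ _ ijl)).
  - by move=> y /BE[_ _ _ <-].
exists (unrotate z) => //; rewrite [LHS]collar_rotate// Eq (funext Ed) (funext Er).
by case: (z) => -[].
Qed.

(** For [t > 0] the point is itself an embedded configuration of [S]; for [t = 0] it is the limit of
    the embedded configurations [x + s v] as [s] tends to 0 from the right. *)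
Lemma collar_closure (S : set 'M[R]_(k.+1, k)) (z : collar_space R k k.+1) :
  0 <= z.1.2 -> (forall t, 0 < t -> S (place z.1.1 t z.2)) ->
  closure (@embed R k k.+1 @` S) (collar z).
Proof.
case: z => -[x t] v /=; rewrite le_eqVlt => /predU1P[<-|t0] Sv; last first.
  by apply: subset_closure; exists (place x t v); [exact: Sv|rewrite collar_gt0].
move=> B /(@collar_cvg0 _ _ _ x v) B0.
have [s [s0 Bs]] : exists s : R, 0 < s /\ B (embed (place x s v)).
  near (0 : R)^'+ => s; exists s; split; near: s; last exact: B0.
  exact: nbhs_right_gt.
by exists (embed (place x s v)); split => //; exists (place x s v) => //; exact: Sv.
Unshelve. all: by end_near. Qed.

(** One inclusion holds because every simplex similar to [p] lies in the image, which is closed; the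
    other applies [collar_closure] both to all configurations and to the similar simplices. *)
Lemma Sim_rotate p x (t : R) : 0 < t -> p = place x t u ->
  Sim p = (@collar R k k.+1 \o rotate) @` @model R k.
Proof.
move=> t0 pE; have ratio_p i j l : ratio p i j l = ratio u i j l.
  by rewrite pE ratio_place.
have ab : ord0 != ord_max :> 'I_k.+1 by rewrite -val_eqE /= eq_sym -lt0n.
apply/seteqP; split.
  move=> z [_]; move: z; apply: closure_rotate => _ [q [cq qp] <-].
  have [y [s [v [s0 nv cv qE]]]] := normalize ab cq.
  have [|A OA vA] := congruence hk Pu cu cv nu nv.
    by move=> i j l ijl; rewrite -(ratio_place y v i j l s0) -qE qp.
  exists (A, s, y); first by split => //; exact: ltW.
  by rewrite qE vA; exact: (@collar_gt0 _ _ _ (y, s, u *m A)).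
move=> _ [w mw <-] /=; have Dw := rotate_dom mw; have [/= OA s0] := mw.
have cw : config (u *m w.1.1) by exact: config_mulmx.
split; first split.
- split => [ij|ijl].
    by rewrite /= /directions enorm_direction//; exact: (valP ij).
  by rewrite /= lee_fin divr_ge0 ?enorm_ge0.
- by apply: collar_closure => // s s1; apply/config_place.
- apply: collar_closure => // s s1; split; first exact/config_place.
  by move=> i j l ijl; rewrite ratio_place//= ratio_mulmx.
Qed.

Lemma diffeomorphic_rotate :
  diffeomorphic (@collar_dom R k k.+1) (@collar R k k.+1) (@model R k)
    ((@collar R k k.+1 \o rotate) @` @model R k).
Proof.
exists (@collar R k k.+1 \o rotate), unrotate; split.
- by move=> z mz; split; [exists z|exact: rotateK].
- by move=> _ [w mw <-] /=; rewrite rotateK.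
- split; first exact: collar_rotate_continuous.
  exists rotate; last by move=> z mz; split => //; exact: rotate_dom.
  by apply: (@Cinf_smooth_on _ _ _ setT _ _ rotate) => //;
    [exact: openT|exact: rotate_Cinf openT].
- split; first exact: (continuous_subspaceT unrotate_continuous).
  apply: (Cinf_smooth_on openT _ (unrotate_coord_Cinf openT)) => //.
  by move=> z [Dz Sz]; apply/esym; exact: unrotate_collar.
Qed.

End Parametrization.

(** * Charts *)

Section Cayley.
Variables (R : realType) (k : nat).
Implicit Types (A Q X : 'M[R]_k).

Definition skew X := X^T = - X.

Lemma skewN X : skew X -> skew (- X).
Proof. by rewrite /skew linearN /= => ->. Qed.

(* [v = v X] with [X] skew forces [v v^T = v X v^T = 0]. *)
Lemma skew_unit X : skew X -> 1%:M - X \in unitmx.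
Proof.
move=> sX; rewrite unitmxE unitfE; apply/negP => /det0P[v v0].
rewrite mulmxBr mulmx1 => /eqP; rewrite subr_eq0 => /eqP vX.
have tr1 (M : 'M[R]_1) : M^T = M by apply/matrixP => i j; rewrite mxE !ord1.
have E : v *m v^T = - (v *m v^T).
  by rewrite {1}vX -[LHS]tr1 !trmx_mul trmxK sX mulNmx mulmxN mulmxA -vX.
have : dot v v = 0.
  rewrite dotE; apply/eqP; rewrite -[_ == 0](mulrn_eq0 _ 2) mulr2n.
  by rewrite {1}E mxE addNr.
by move/eqP; rewrite dotvv_eq0 (negbTE v0).
Qed.

Lemma skew_unitD X : skew X -> 1%:M + X \in unitmx.
Proof. by move/skewN/skew_unit; rewrite opprK. Qed.

Definition cayley X := invmx (1%:M - X) *m (1%:M + X).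
Definition uncayley Q := (Q - 1%:M) *m invmx (1%:M + Q).

Lemma mulmx_1BD X : (1%:M - X) *m (1%:M + X) = (1%:M + X) *m (1%:M - X).
Proof.
rewrite mulmxDr mulmx1 mulmxBl mul1mx addrA subrK.
by rewrite mulmxBr mulmx1 mulmxDl mul1mx opprD addrA addrK.
Qed.

(** Transposition exchanges [1 - X] and [1 + X], and these two commute. *)
Lemma cayley_orthogonal X : skew X -> orthogonal_group (cayley X).
Proof.
move=> sX; have u1 := skew_unit sX; have u2 := skew_unitD sX.
have tD : (1%:M + X)^T = 1%:M - X by rewrite linearD /= trmx1 sX.
have tB : (1%:M - X)^T = 1%:M + X by rewrite linearB /= trmx1 sX opprK.
rewrite /orthogonal_group /= /cayley trmx_mul trmx_inv tD tB.
rewrite mulmxA -(mulmxA _ _ (1%:M - X)) -mulmx_1BD mulmxA mulVmx// mul1mx.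
by rewrite mulmxV.
Qed.

(** With 1 written as [(1 - X)^-1 (1 - X)], the numerators add up to 2. Hence -1 is never an
    eigenvalue of a Cayley transform. *)
Lemma cayley_add1 X : skew X -> 1%:M + cayley X = 2 *: invmx (1%:M - X).
Proof.
move=> sX; have u1 := skew_unit sX.
rewrite /cayley -{1}(mulVmx u1) -mulmxDr [X in _ *m X](_ : _ = 2 *: 1%:M).
  by rewrite -scalemxAr mulmx1.
by rewrite addrACA addNr addr0 scaler_nat mulr2n.
Qed.

Lemma cayley_unit X : skew X -> 1%:M + cayley X \in unitmx.
Proof. by move=> sX; rewrite cayley_add1// unitmxZ ?unitmx_inv ?skew_unit ?unitfE. Qed.

Lemma cayleyK X : skew X -> uncayley (cayley X) = X.
Proof.
move=> sX; have u1 := skew_unit sX; have u2 := cayley_unit sX.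
have XC : (1%:M - X) *m X = X *m (1%:M - X).
  by rewrite mulmxBl mulmxBr mulmx1 mul1mx.
have cE : (1%:M - X) *m cayley X = 1%:M + X by rewrite mulKVmx.
(* Both denominators are cleared, [1 + cayley X] on the right and [1 - X] on the left, leaving a
   polynomial identity in [X]. *)
apply: (can_inj (mulmxK u2)); rewrite /uncayley mulmxKV//.
apply: (can_inj (mulKmx u1)); rewrite mulmxA XC -mulmxA mulmxBr mulmxDr mulmx1 cE.
rewrite opprB [LHS]addrC addrA subrK mulmxDr mulmxBr mulmxDr mulmx1.
by rewrite [RHS]addrC addrACA subrr addr0.
Qed.

(** Multiplying by [1 + Q^T] on the left and [1 + Q] on the right clears the inverses; [Q^T Q = 1]
    reduces the claim to [Q^T - Q = - (Q - Q^T)]. *)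
Lemma uncayley_skew Q : orthogonal_group Q -> 1%:M + Q \in unitmx ->
  skew (uncayley Q).
Proof.
move=> OQ uQ; have uQ' : 1%:M + Q^T \in unitmx.
  by rewrite -unitmx_tr linearD /= trmx1 trmxK.
have QQ : Q^T *m Q = 1%:M by exact: mulmx1C.
have tD : (1%:M + Q)^T = 1%:M + Q^T by rewrite linearD /= trmx1.
have tB : (Q - 1%:M)^T = Q^T - 1%:M by rewrite linearB /= trmx1.
rewrite /skew /uncayley trmx_mul trmx_inv tD tB.
apply: (can_inj (mulKmx uQ')); rewrite mulKVmx// mulmxN mulmxA.
apply: (can_inj (mulmxK uQ)); rewrite mulNmx mulmxKV//.
have -> : (Q^T - 1%:M) *m (1%:M + Q) = Q^T - Q.
  by rewrite mulmxDr mulmx1 mulmxBl QQ mul1mx addrA subrK.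
have -> : (1%:M + Q^T) *m (Q - 1%:M) = Q - Q^T.
  by rewrite mulmxBr mulmx1 mulmxDl mul1mx QQ opprD addrA addrK.
by rewrite opprB.
Qed.

(** For [X = uncayley Q], [(1 + X)(1 + Q) = 2 Q] and [(1 - X)(1 + Q) = 2], whose quotient is [Q]. *)
Lemma uncayleyK Q : orthogonal_group Q -> 1%:M + Q \in unitmx ->
  cayley (uncayley Q) = Q.
Proof.
move=> OQ uQ; have sX := uncayley_skew OQ uQ; have u1 := skew_unit sX.
have uncE : uncayley Q *m (1%:M + Q) = Q - 1%:M by rewrite mulmxKV.
have eD : (1%:M + uncayley Q) *m (1%:M + Q) = Q + Q.
  by rewrite mulmxDl mul1mx uncE addrC addrA subrK.
have eB : (1%:M - uncayley Q) *m (1%:M + Q) = 1%:M + 1%:M.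
  by rewrite mulmxBl mul1mx uncE opprB addrACA subrr addr0.
have QC : Q *m (1%:M + Q) = (1%:M + Q) *m Q.
  by rewrite mulmxDl mulmxDr mulmx1 mul1mx.
apply: (can_inj (mulKmx u1)); rewrite /cayley mulKVmx//.
apply: (can_inj (mulmxK uQ)).
by rewrite eD -mulmxA QC mulmxA eB mulmxDl mul1mx.
Qed.

(** The matrix of [X |-> X^T + X] on vectorized matrices: its kernel is the space of skew-symmetric
    matrices, whose dimension [skew_dim] is that of [O(k)]. *)
Definition skew_system : 'M[R]_(k * k) := lin_mx (@trmx R k k) + 1%:M.
Definition skew_basis := row_base (kermx skew_system).
Definition skew_dim := \rank (kermx skew_system).

Definition skew_of (w : 'rV[R]_skew_dim) : 'M[R]_k := vec_mx (w *m skew_basis).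
Definition skew_coord X : 'rV[R]_skew_dim := mxvec X *m pinvmx skew_basis.

Lemma skewP X : skew X <-> (mxvec X <= skew_basis)%MS.
Proof.
rewrite eq_row_base /skew_system; split=> [sX|/sub_kermxP].
  apply/sub_kermxP; rewrite mulmxDr mulmx1 mul_vec_lin /= sX.
  by rewrite linearN addNr.
rewrite mulmxDr mulmx1 mul_vec_lin -linearD /= => /(congr1 vec_mx).
by rewrite mxvecK linear0 => /eqP; rewrite addr_eq0 => /eqP.
Qed.

Lemma skew_of_skew w : skew (skew_of w).
Proof. by apply/skewP; rewrite vec_mxK submxMl. Qed.

Lemma skew_ofK w : skew_coord (skew_of w) = w.
Proof. by rewrite /skew_coord vec_mxK mulmxKp// row_base_free. Qed.

Lemma skew_coordK X : skew X -> skew_of (skew_coord X) = X.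
Proof. by move/skewP => sX; rewrite /skew_of mulmxKpV// mxvecK. Qed.

End Cayley.

(** * Charts of the model around an orthogonal matrix [A0] *)

Section Charts.
Variables (R : realType) (k : nat) (A0 : 'M[R]_k).
Hypothesis OA0 : orthogonal_group A0.

Local Notation V0 := ('M[R]_k * R^o * 'rV[R]_k)%type.
Local Notation r := (skew_dim R k).

(** The size comes first among the coordinates, so that [quadrant 1] constrains exactly that one;
    then come the centroid and the skew-symmetric parameter. *)
Definition chart (y : 'rV[R]_(1 + (k + r))) : V0 :=
  (A0 *m cayley (skew_of (rsubmx (rsubmx y))), lsubmx y 0 0, lsubmx (rsubmx y)).

Definition unchart (z : V0) : 'rV[R]_(1 + (k + r)) :=
  row_mx z.1.2%:M (row_mx z.2 (skew_coord (uncayley (A0^T *m z.1.1)))).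

(** No orthogonality is imposed here, so this set is open in the whole vector space and [unchart]
    can be smooth on it. *)
Definition chart_image : set V0 := [set z | 1%:M + A0^T *m z.1.1 \in unitmx].

Lemma chart_model y : quadrant 1 y -> model (chart y).
Proof.
move=> y0; split; last by rewrite /= mxE; exact: y0.
have OC := cayley_orthogonal (skew_of_skew (rsubmx (rsubmx y))).
by rewrite /orthogonal_group /= trmx_mul mulmxA -(mulmxA A0) OC mulmx1.
Qed.

Lemma chart_in_image y : chart_image (chart y).
Proof.
rewrite /chart_image /= mulmxA (mulmx1C OA0) mul1mx.
exact/cayley_unit/skew_of_skew.
Qed.

Lemma chartK : cancel chart unchart.
Proof.
move=> y; rewrite /unchart /= mulmxA (mulmx1C OA0) mul1mx.
by rewrite (cayleyK (skew_of_skew _)) skew_ofK hsubmxK -mx11_scalar hsubmxK.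
Qed.

Lemma unchart_quadrant z : model z -> quadrant 1 (unchart z).
Proof.
move=> [_ z0] i; rewrite ltnS leqn0 => /eqP i0.
have -> : i = lshift (k + r) (0 : 'I_1) by exact/val_inj.
by rewrite row_mxEl mxE eqxx mulr1n.
Qed.

Lemma unchartK z : model z -> chart_image z -> chart (unchart z) = z.
Proof.
case: z => -[A t] x [/= OA t0] uA.
have OQ : orthogonal_group (A0^T *m A).
  rewrite /orthogonal_group /= trmx_mul trmxK mulmxA -(mulmxA _ A) OA mulmx1.
  exact: mulmx1C.
rewrite /chart /unchart /= !row_mxKr !row_mxKl skew_coordK; last exact: uncayley_skew.
by rewrite uncayleyK// mulmxA OA0 mul1mx mxE eqxx mulr1n.
Qed.

Lemma chart_Cinf : Cinf setT chart.
Proof.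
have c1 : Cinf setT (fun y : 'rV[R]_(1 + (k + r)) => skew_of (rsubmx (rsubmx y))).
  have l1 : linear (fun y : 'rV[R]_(1 + (k + r)) => skew_of (rsubmx (rsubmx y))).
    by move=> a v w; rewrite /skew_of !linearP mulmxDl -scalemxAl linearP.
  by apply: Cinf_linear => //; exact: mx_linear_continuous.
apply: Cinf_pair; [exact: openT| |]; last first.
  have l2 : linear (fun y : 'rV[R]_(1 + (k + r)) => lsubmx (rsubmx y)).
    by move=> a v w; rewrite !linearP.
  by apply: Cinf_linear => //; exact: mx_linear_continuous.
apply: Cinf_pair; [exact: openT| |]; last first.
  have l3 : linear (fun y : 'rV[R]_(1 + (k + r)) => lsubmx y 0 0 : R^o).
    by move=> a v w; rewrite !mxE.
  by apply: Cinf_linear => //; exact: mx_linear_continuous.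
apply: Cinf_mulmx; [exact: openT|exact: Cinf_cst|].
have lN : linear (fun X : 'M[R]_k => - X).
  by move=> a v w; rewrite opprD scalerN.
apply: Cinf_mulmx; [exact: openT| |].
  (* [skew_of] takes only skew-symmetric values, so the inverse in the Cayley transform exists for
     every [y]. *)
  apply: Cinf_invmx; [exact: openT|by move=> y _; exact/skew_unit/skew_of_skew|].
  apply: CinfD; [exact: openT|exact: Cinf_cst|].
  apply: (@Cinf_postcomp _ _ _ _ _ (fun X => - X)) => //; first exact: openT.
  exact: mx_linear_continuous.
by apply: CinfD; [exact: openT|exact: Cinf_cst|].
Qed.

Lemma Cinf_frame (A : set V0) : open A -> Cinf A (fun z : V0 => A0^T *m z.1.1).
Proof.
move=> oA; apply: Cinf_mulmx => //; first exact: Cinf_cst.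
apply: (@Cinf_postcomp _ _ _ _ _ fst) => //; last exact: Cinf_fst.
exact: continuous_fst.
Qed.

Lemma open_chart_image : open chart_image.
Proof.
have cd : continuous (fun z : V0 => \det (1%:M + A0^T *m z.1.1) : R^o).
  apply: Cinf_continuous; apply: Cinf_det; first exact: openT.
  by apply: CinfD; [exact: openT|exact: Cinf_cst|exact: Cinf_frame openT].
rewrite (_ : chart_image =
  (fun z : V0 => \det (1%:M + A0^T *m z.1.1) : R^o) @^-1` [set x | x != 0]).
  by apply: open_comp => [z _|]; [exact: cd|exact: open_neq].
by apply/seteqP; split => z; rewrite /chart_image /= unitmxE unitfE.
Qed.

Lemma unchart_Cinf : Cinf chart_image unchart.
Proof.
have oU := open_chart_image.
have cA := Cinf_frame oU.
have l1 : linear (fun X : 'M[R]_k => skew_coord X).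
  by move=> a v w; rewrite /skew_coord linearP mulmxDl -scalemxAl.
have cX : Cinf chart_image (fun z => skew_coord (uncayley (A0^T *m z.1.1))).
  apply: (@Cinf_postcomp _ _ _ _ _ (fun X => skew_coord X)) => //.
    exact: mx_linear_continuous.
  apply: Cinf_mulmx => //; last first.
    apply: Cinf_invmx => //; apply: CinfD => //; exact: Cinf_cst.
  by apply: CinfD => //; exact: Cinf_cst.
have ct : Cinf chart_image (fun z : V0 => z.1.2).
  apply: (@Cinf_postcomp _ _ _ _ _ snd) => //; last exact: Cinf_fst.
  exact: continuous_snd.
apply: Cinf_mx => // i j; rewrite /unchart (ord1 i).
case: (fintype.splitP j) => [j0|j1] jE.
  have -> : j = lshift (k + r) j0 by exact: val_inj.
  rewrite (_ : (fun z : V0 => _) = fun z : V0 => z.1.2)//.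
  by apply/funext => z; rewrite row_mxEl mxE (ord1 j0) eqxx mulr1n.
have -> : j = rshift 1 j1 by exact: val_inj.
under eq_fun do rewrite row_mxEr.
case: (fintype.splitP j1) => [j2|j2] j1E.
  have -> : j1 = lshift r j2 by exact: val_inj.
  under eq_fun do rewrite row_mxEl.
  by apply: Cinf_coord => //; exact: Cinf_snd.
have -> : j1 = rshift k j2 by exact: val_inj.
under eq_fun do rewrite row_mxEr.
exact: Cinf_coord.
Qed.

End Charts.

(** * Transport of the charts to the image in the compactified space *)

Section Submanifold.
Variables (R : realType) (k : nat) (u : 'M[R]_(k.+1, k)).
Hypotheses (hk : (0 < k)%N) (cu : config u) (nu : normalized u).
Hypothesis Pu : edges u \in unitmx.

Local Notation V0 := ('M[R]_k * R^o * 'rV[R]_k)%type.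
Local Notation S := ((@collar R k k.+1 \o rotate u) @` @model R k).

Lemma submanifold_rotate (M : set (ambient R k k.+1)) : S `<=` M ->
  submanifold (@collar_dom R k k.+1) (@collar R k k.+1) M S.
Proof.
move=> SM; split => //; exists (1 + (k + skew_dim R k))%N => p [w mw <-{p}].
have [OA0 _] := mw; set A0 := w.1.1 in OA0.
have oI := @open_chart_image R k A0.
have cU := @unrotate_continuous R k u.
pose Q : set 'rV[R]_(1 + (k + skew_dim R k)) := quadrant 1.
(* The chart is defined on the full quadrant with one boundary coordinate; continuity of [unrotate]
   on the ambient space makes the preimage of [chart_image] an open neighbourhood. *)
exists 1%N, setT, (unrotate u @^-1` chart_image A0); rewrite setTI -/Q; split.
- exact: openT.
- split; first by apply: open_comp => // z _; exact: cU.
  (* At the base point [A0^T A0 = 1], so the matrix to be inverted is twice the identity. *)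
  rewrite /= rotateK// /chart_image /= (mulmx1C OA0).
  by rewrite -mulr2n -scaler_nat unitmxZ ?unitmx1// unitfE pnatr_eq0.
have QV y : Q y -> model (chart A0 y) by exact: chart_model.
exists (fun y => collar (rotate u (chart A0 y))), (fun z => unchart A0 (unrotate u z)).
split.
- move=> y /QV my; rewrite rotateK// chartK//; split => //; split.
    by exists (chart A0 y).
  by rewrite /= rotateK//; exact: chart_in_image.
- move=> _ [[z mz <-]]; rewrite /= rotateK// => Iz.
  by split; [exact: unchart_quadrant|rewrite unchartK].
- have cc : continuous (chart A0) by apply/Cinf_continuous/chart_Cinf.
  split.
    exact: (within_continuous_compose cc QV (@collar_rotate_continuous R k u)).
  exists (fun y => rotate u (chart A0 y)); last first.
    by move=> y Qy; split => //; apply: rotate_dom => //; exact: QV.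
  apply: (@Cinf_smooth_on _ _ _ setT _ _ (fun y => rotate u (chart A0 y))) => //.
    exact: openT.
  apply: Cinf_postcomp; [exact: openT|exact: rotate_linear|exact: rotate_continuous|].
  exact: chart_Cinf.
split.
  apply: continuous_in_subspaceT => z; rewrite inE => -[_ Iz].
  apply: (@continuous_comp _ _ _ (unrotate u) (unchart A0)); first exact: cU.
  by apply: (@unchart_Cinf R k A0 0).
(* In coordinates the inverse chart extends smoothly as [unchart A0 \o unrotate_coord u] to this
   open set; [unrotate_collar] shows the agreement over the image. *)
have oL : open (unrotate_coord u @^-1` chart_image A0).
  by apply: open_comp => // z _; exact: unrotate_coord_continuous.
apply: (Cinf_smooth_on oL _ (Cinf_precomp oI (@unrotate_coord_linear R k u)
    (@unrotate_coord_continuous R k u) (@unchart_Cinf R k A0))).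
  by move=> z [Dz [Sz Iz]]; rewrite /= -unrotate_collar.
by move=> z [Dz [Sz Iz]]; rewrite /= unrotate_collar.
Qed.

End Submanifold.

Theorem corollary22 (R : realType) (k : nat) (hk : (0 < k)%N)
    (p : 'M[R]_(k.+1, k)) (hp : nondegenerate_simplex p) :
  submanifold (@collar_dom R k k.+1) (@collar R k k.+1)
    (@compactified R k k.+1) (Sim p) /\
  diffeomorphic (@collar_dom R k k.+1) (@collar R k k.+1)
    (@model R k) (Sim p).
Proof.
have ab : ord0 != ord_max :> 'I_k.+1 by rewrite -val_eqE /= eq_sym -lt0n.
have [x [t [u [t0 nu cu pE]]]] := normalize ab hp.1.
(* Scaling by [t > 0] transfers invertibility of the edge matrix from [p] to its normalization
   [u]. *)
have Pu : edges u \in unitmx.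
  have := edges_unit hp; rewrite pE edges_place unitmxZ// unitfE.
  by rewrite gt_eqF.
have SimE := Sim_rotate hk cu nu Pu t0 pE.
split; last by rewrite SimE; exact: diffeomorphic_rotate.
rewrite SimE; apply: submanifold_rotate => //.
by rewrite -SimE => z [].
Qed.
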